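(* Let $m\ge2$, let $k\in[m]$, and let $A$ be an $m\times m$ nonnegative definite hermitian matrix with $\det A>0$ such that the function $w:2^{[m]}\to\mathbb{R}$, $w(I):=\operatorname{tr}\log A[I]$, is nondecreasing. Then the subset $I\subset[m]$ of cardinality $k$ returned by the greedy algorithm (described in the context) on input $(A,k)$ satisfies $$\big\|A-A[[m],I]\,A[I]^{-1}A[[m],I]^*\big\|_{\infty,e}\le (k+1)\,\mu_k(A)^{e^{-1}}\,\sigma_{k+1}(A).$$
   Context: $[m]=\{1,\dots,m\}$. $A[I,J]$ is the submatrix of $A$ with rows indexed by $I$ and columns indexed by $J$; $A[I]=A[I,I]$. $w(\emptyset)=0$ (i.e. $\det A[\emptyset]=1$), and $w$ is nondecreasing if $w(I)\le w(J)$ whenever $I\subset J\subset[m]$. $\|B\|_{\infty,e}=\max_{i,j}|b_{ij}|$ is the entrywise max-norm. $\sigma_1(A)\ge\sigma_2(A)\ge\cdots$ are the singular values of $A$, with $\sigma_j(A)=0$ for $j>\operatorname{rank}A$. $\mu_k(A):=\max\{|\det A[I,J]|: I,J\subset[m],\ |I|=|J|=k\}$. Greedy algorithm. Input: nonnegative definite hermitian $A$ and $k\in[m]$. Initialize a working matrix $B=(b_{pq}):=A$, $I:=\emptyset$, $K:=[m]$, $t:=1$. Repeat: choose $i\in K$ with $b_{ii}=\max_{j\in K}b_{jj}$; if $b_{ii}=0$, set $I:=[k]$, $t:=0$ and exit; otherwise set $I:=I\cup\{i\}$, $K:=K\setminus\{i\}$, $t:=t\,b_{ii}$; if $|I|=k$,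 exit; for all $p,q\in K$ replace $b_{pq}$ by $b_{pq}-b_{pi}b_{iq}/b_{ii}$. Output: $I$ (of cardinality $k$) and $t=\det A[I]$. *)

(* Defs.v *)
(* The complex numbers are R[i] for R : realType. *)
From HB Require Import structures.
From mathcomp Require Import all_boot all_order all_algebra.
From mathcomp Require Import spectral sesquilinear.
From mathcomp Require Import complex.
From mathcomp Require Import reals sequences exp.

Set Implicit Arguments.
Unset Strict Implicit.
Unset Printing Implicit Defensive.

Import Order.TTheory GRing.Theory Num.Theory.
Local Open Scope ring_scope.
Local Open Scope complex_scope.
Local Open Scope sesquilinear_scope.

(* In R[i], [0 <= z] means that z is real and nonnegative. *)
Definition nonneg_definite (R : realType) (m : nat) (A : 'M[R[i]]_m) : Prop :=
  A \is hermsymmx /\ forall x : 'cV[R[i]]_m, 0 <= (x ^t* *m A *m x) 0 0.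

(* A[I, J]; [enum_val] lists a set of indices in increasing order. *)
Definition submatrix (T : Type) (m n : nat) (A : 'M[T]_(m, n))
    (I : {set 'I_m}) (J : {set 'I_n}) : 'M[T]_(#|I|, #|J|) :=
  mxsub (@enum_val _ (mem I)) (@enum_val _ (mem J)) A.

(* A[[m], J] *)
Definition subcols (T : Type) (m n : nat) (A : 'M[T]_(m, n))
    (J : {set 'I_n}) : 'M[T]_(m, #|J|) :=
  colsub (@enum_val _ (mem J)) A.

(* The logarithm of a positive definite hermitian matrix, by functional
   calculus: A = P^-1 D P with P unitary and D = diag (spectral_diag A) real,
   and log A = P^-1 (ln D) P. *)
Definition mxlog (R : realType) (n : nat) (A : 'M[R[i]]_n) : 'M[R[i]]_n :=
  invmx (spectralmx A)
  *m diag_mx (map_mx (fun z => (ln (complex.Re z))%:C) (spectral_diag A))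
  *m spectralmx A.

(* The trace is real when A[I] is positive definite; the trace of the
   0 x 0 matrix gives w(set0) = 0. *)
Definition trlog (R : realType) (m : nat) (A : 'M[R[i]]_m)
    (I : {set 'I_m}) : R :=
  complex.Re (\tr (mxlog (submatrix A I I))).

Definition nondecreasing_setfun (R : realType) (m : nat)
    (w : {set 'I_m} -> R) : Prop :=
  forall I J : {set 'I_m}, I \subset J -> w I <= w J.

Definition maxnorm (R : realType) (m n : nat) (B : 'M[R[i]]_(m, n)) : R :=
  \big[Num.max/0]_(i < m) \big[Num.max/0]_(j < n) ComplexField.Normc.normc (B i j).

(* Eigenvalues of A^* A with multiplicity, in nonincreasing order. *)
Definition gram_eigenvalues (R : realType) (m n : nat)
    (A : 'M[R[i]]_(m, n)) : seq R :=
  sort (fun x y : R => y <= x)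
    [seq complex.Re (spectral_diag (A ^t* *m A) 0 j) | j <- enum 'I_n].

(* Singular values are numbered from 1, so only j >= 1 is meaningful; the
   default value 0 is used beyond the number of columns. *)
Definition singular_value (R : realType) (m n : nat)
    (A : 'M[R[i]]_(m, n)) (j : nat) : R :=
  Num.sqrt (nth 0 (gram_eigenvalues A) j.-1).

(* [conform_mx] only casts A[I, J] to a k x k matrix, as #|I| = #|J| = k. *)
Definition max_minor (R : realType) (m : nat) (A : 'M[R[i]]_m) (k : nat) : R :=
  \big[Num.max/0]_(I : {set 'I_m} | #|I| == k)
  \big[Num.max/0]_(J : {set 'I_m} | #|J| == k)
    ComplexField.Normc.normc (\det (conform_mx (0 : 'M[R[i]]_k) (submatrix A I J))).

Definition is_pivot (R : realType) (m : nat) (B : 'M[R[i]]_m)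
    (K : {set 'I_m}) (i : 'I_m) : Prop :=
  i \in K /\ forall j, j \in K -> B j j <= B i i.

Definition eliminate (R : realType) (m : nat) (B : 'M[R[i]]_m)
    (K : {set 'I_m}) (i : 'I_m) : 'M[R[i]]_m :=
  \matrix_(p, q) if (p \in K) && (q \in K)
                 then B p q - B p i * B i q / B i i else B p q.

(* [greedy_loop k B I K t Iout tout]: started in the state (B, I, K, t), the
   main loop of the greedy algorithm may return (Iout, tout).  It is a relation
   because ties between pivots may be broken arbitrarily. *)
Inductive greedy_loop (R : realType) (m k : nat) :
    'M[R[i]]_m -> {set 'I_m} -> {set 'I_m} -> R[i] ->
    {set 'I_m} -> R[i] -> Prop :=
| GreedyZero B I K t i :
    is_pivot B K i -> B i i = 0 ->
    greedy_loop k B I K t [set j : 'I_m | (j < k)%N] 0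
| GreedyDone B I K t i :
    is_pivot B K i -> B i i <> 0 -> #|i |: I| = k ->
    greedy_loop k B I K t (i |: I) (t * B i i)
| GreedyStep B I K t i Iout tout :
    is_pivot B K i -> B i i <> 0 -> #|i |: I| <> k ->
    greedy_loop k (eliminate B (K :\ i) i) (i |: I) (K :\ i) (t * B i i)
      Iout tout ->
    greedy_loop k B I K t Iout tout.

Definition greedy_returns (R : realType) (m : nat) (A : 'M[R[i]]_m) (k : nat)
    (I : {set 'I_m}) (t : R[i]) : Prop :=
  greedy_loop k A set0 [set: 'I_m] 1 I t.

(* Main.v *)
Require Import Defs.
From mathcomp Require Import all_boot all_order all_algebra.
From mathcomp Require Import spectral sesquilinear.
From mathcomp Require Import complex.
From mathcomp Require Import reals sequences exp.
From mathcomp Require Import perm lra.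

(** Let S be the Schur complement of A[I], extended by zero to [m] x [m]; this is
    the matrix to be bounded.  It is nonnegative definite, so its largest entry
    lies on the diagonal ([psd_entry_le]), and it suffices to bound S_jj for j
    outside I.

    Put J0 = j |: I.  Since det A[J0] = det A[I] S_jj ([pminor_setU1]), the diagonal
    of the inverse of A[J0] consists of the numbers
    det A[J0 \ l] / (det A[I] S_jj).  If rho bounds all ratios
    det A[J0 \ l] / det A[I], the trace of the inverse, and with it its largest
    eigenvalue, is at most (k+1) rho / S_jj.  Therefore A stretches the vectors
    supported in J0 at least by the factor S_jj / ((k+1) rho), and as these vectors
    form a space of dimension k+1, the min-max principle ([gram_eigenvalue_ge])
    yields S_jj <= (k+1) rho sigma_(k+1) ([residual_le_singular]).

    It remains to take rho = mu_k^(1/e).  As w is nondecreasing with w(set0) = 0,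
    every principal minor is at least 1 and det A[J] <= det A[J0] = det A[I] S_jj for each
    k-subset J of J0, so the ratio r = det A[J] / det A[I] is at most S_jj.  The
    greedy rule makes S_jj at most every pivot, and the product of the k
    pivots is det A[I]; so S_jj^k <= det A[I].  Hence
    r^(k+1) <= r det A[I] = det A[J] <= mu_k, and r <= mu_k^(1/(k+1)), which for
    k >= 2 is at most mu_k^(1/e) because e < 3 <= k+1.  For k = 1 the first pivot is
    the largest diagonal entry of A and r <= 1 ([minor_ratio_le]).

    The two facts about the pivots are carried through the algorithm as the
    invariant [greedy_inv], which refers to the current Schur complement; the
    working matrix agrees with it on the indices not yet chosen. *)

Import Order.TTheory GRing.Theory Num.Theory.
Local Open Scope ring_scope.
Local Open Scope complex_scope.
Local Open Scope sesquilinear_scope.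

Set Implicit Arguments.
Unset Strict Implicit.
Unset Printing Implicit Defensive.

(** * Hermitian matrices in their eigenbasis *)

Lemma adjointM (R : realType) m n p (A : 'M[R[i]]_(m, n)) (B : 'M_(n, p)) :
  (A *m B) ^t* = B ^t* *m A ^t*.
Proof. by rewrite trmx_mul map_mxM. Qed.

Lemma hermitian_adjoint (R : realType) m (A : 'M[R[i]]_m) :
  A \is hermsymmx -> A ^t* = A.
Proof. by move/is_hermitianmxP => {2}->; rewrite expr0 scale1r. Qed.

Lemma adjoint_hermitian (R : realType) m (A : 'M[R[i]]_m) :
  A ^t* = A -> A \is hermsymmx.
Proof. by move=> eqA; apply/is_hermitianmxP; rewrite expr0 scale1r eqA. Qed.

Lemma sqnormE (R : realType) m (x : 'cV[R[i]]_m) :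
  (x ^t* *m x) 0 0 = \sum_j `|x j 0| ^+ 2.
Proof. by rewrite mxE; apply: eq_bigr => j _; rewrite !mxE normCKC. Qed.

Lemma spectral_decomp (R : realType) m (A : 'M[R[i]]_m) : A \is hermsymmx ->
  A = (spectralmx A) ^t* *m diag_mx (spectral_diag A) *m spectralmx A.
Proof.
move=> /hermitian_normalmx /orthomx_spectralP {1}->.
by rewrite invmx_unitary ?spectral_unitarymx.
Qed.

Lemma quad_spectral (R : realType) m (A : 'M[R[i]]_m) (x : 'cV[R[i]]_m) :
  A \is hermsymmx ->
  (x ^t* *m A *m x) 0 0 =
  \sum_j spectral_diag A 0 j * `|(spectralmx A *m x) j 0| ^+ 2.
Proof.
move=> hA; rewrite {1}(spectral_decomp hA) !mulmxA -adjointM -mulmxA mxE.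
apply: eq_bigr => j _.
by rewrite mul_mx_diag !mxE mulrAC normCKC mulrC.
Qed.

Lemma sqnorm_spectralmx (R : realType) m (A : 'M[R[i]]_m) (x : 'cV[R[i]]_m) :
  \sum_j `|(spectralmx A *m x) j 0| ^+ 2 = (x ^t* *m x) 0 0.
Proof.
rewrite -sqnormE adjointM !mulmxA mulmxKtV //; exact: spectral_unitarymx.
Qed.

Lemma det_spectral (R : realType) m (A : 'M[R[i]]_m) : A \is hermsymmx ->
  \det A = \prod_j spectral_diag A 0 j.
Proof.
move=> /hermitian_normalmx /orthomx_spectralP {1}->.
rewrite !det_mulmx mulrAC det_inv mulVr ?mul1r ?det_diag //.
by rewrite -unitmxE spectral_unit.
Qed.

Lemma spectral_diag_ge0 (R : realType) m (A : 'M[R[i]]_m) j :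
  nonneg_definite A -> 0 <= spectral_diag A 0 j.
Proof.
move=> [hA psdA]; have := psdA ((spectralmx A) ^t* *m delta_mx j 0).
rewrite quad_spectral // mulmxA (unitarymxP (spectral_unitarymx A)) mul1mx.
rewrite (bigD1 j) //= big1 ?addr0 => [|l /negPf lj].
  by rewrite mxE !eqxx normr1 expr1n mulr1.
by rewrite mxE lj normr0 expr0n mulr0.
Qed.

Lemma spectral_diag_gt0 (R : realType) m (A : 'M[R[i]]_m) j :
  nonneg_definite A -> 0 < \det A -> 0 < spectral_diag A 0 j.
Proof.
move=> psdA; rewrite det_spectral ?(proj1 psdA) // => /gt_eqF/negbT detA.
rewrite lt0r spectral_diag_ge0 // andbT; move: detA.
by rewrite prodf_seq_neq0 => /allP/(_ j); rewrite mem_index_enum; apply.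
Qed.

Lemma ln_prod (R : realType) (T : finType) (f : T -> R) :
  (forall j, 0 < f j) -> ln (\prod_j f j) = \sum_j ln (f j).
Proof.
move=> f0.
suff [] : ln (\prod_i f i) = \sum_i ln (f i) /\ 0 < \prod_i f i by [].
elim/big_rec2: _ => [|i y1 y2 _ [IH y0]]; first by rewrite ln1.
by rewrite -IH lnM ?posrE ?mulr_gt0.
Qed.

(** Each function value of A is diagonal in the eigenbasis of A, so the trace of
    log A sums the logarithms of the eigenvalues and the determinant multiplies
    the eigenvalues.  Through this the hypothesis on the set function w becomes
    monotonicity of the principal minors. *)
Lemma trace_mxlog (R : realType) m (A : 'M[R[i]]_m) :
  nonneg_definite A -> 0 < \det A ->
  complex.Re (\tr (mxlog A)) = ln (complex.Re (\det A)).
Proof.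
move=> psdA detA.
rewrite /mxlog mxtrace_mulC mulmxA mulmxV ?spectral_unit // mul1mx.
rewrite mxtrace_diag det_spectral ?(proj1 psdA) //.
have dE j : spectral_diag A 0 j = (complex.Re (spectral_diag A 0 j))%:C.
  by rewrite RRe_real // ger0_real // spectral_diag_ge0.
rewrite (eq_bigr (fun j => (ln (complex.Re (spectral_diag A 0 j)))%:C)); last first.
  by move=> j _; rewrite mxE.
rewrite -rmorph_sum /= (eq_bigr _ (fun j _ => dE j)) -rmorph_prod /=.
by rewrite ln_prod // => j; rewrite -ltcR -dE spectral_diag_gt0.
Qed.

(** In eigencoordinates y of x the form is the sum of lambda_j |y_j|^2 with every
    lambda_j positive, so no coordinate can survive. *)
Lemma psd_isotropic (R : realType) m (A : 'M[R[i]]_m) (x : 'cV[R[i]]_m) :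
  nonneg_definite A -> 0 < \det A -> (x ^t* *m A *m x) 0 0 = 0 -> x = 0.
Proof.
move=> psdA detA; rewrite quad_spectral ?(proj1 psdA) //.
move/eqP; rewrite psumr_eq0 => [/allP z|j _]; last first.
  by rewrite mulr_ge0 ?exprn_ge0 ?spectral_diag_ge0.
have : spectralmx A *m x = 0.
  apply/matrixP => j l; rewrite ord1 [RHS]mxE; apply/eqP.
  have := z j (mem_index_enum _).
  by rewrite mulf_eq0 gt_eqF ?spectral_diag_gt0 //= sqrf_eq0 normr_eq0.
move/(congr1 (mulmx (invmx (spectralmx A)))).
by rewrite mulKmx ?spectral_unit // mulmx0.
Qed.

Lemma nonneg_congr (R : realType) m n (A : 'M[R[i]]_m) (F : 'M[R[i]]_(m, n)) :
  nonneg_definite A -> nonneg_definite (F ^t* *m A *m F).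
Proof.
move=> [hA psdA]; split.
  apply: adjoint_hermitian.
  by rewrite !adjointM trmxCK hermitian_adjoint // mulmxA.
by move=> x; have := psdA (F *m x); rewrite adjointM !mulmxA.
Qed.

(** A kernel vector of F^* A F would be mapped by F to an isotropic vector of A.
    Taking for F a coordinate embedding, principal minors of A are positive. *)
Lemma det_congr_gt0 (R : realType) m n (A : 'M[R[i]]_m) (F : 'M[R[i]]_(m, n)) :
  nonneg_definite A -> 0 < \det A -> (forall x : 'cV_n, F *m x = 0 -> x = 0) ->
  0 < \det (F ^t* *m A *m F).
Proof.
move=> psdA detA injF; have psdG := nonneg_congr F psdA.
rewrite lt0r det_spectral ?(proj1 psdG) // prodr_ge0 => [|j _]; last first.
  exact: spectral_diag_ge0.
rewrite andbT -det_spectral ?(proj1 psdG) //; apply/negP => /det0P[v v0 vG].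
suff /injF vs0 : F *m v ^t* = 0.
  by move: v0; rewrite -[v]trmxCK vs0 trmx0 map_mx0 eqxx.
apply: (psd_isotropic psdA detA).
by rewrite !mulmxA in vG; rewrite adjointM trmxCK !mulmxA vG mul0mx mxE.
Qed.

(** * Principal submatrices and principal minors *)

(** The isometry of C^n into C^m that puts coordinate l at position f l; it turns
    principal submatrices into congruences, which preserve nonnegativity. *)
Definition coord_embed (R : realType) m n (f : 'I_n -> 'I_m) : 'M[R[i]]_(m, n) :=
  colsub f 1%:M.

Lemma mxsub_congr (R : realType) m n (f : 'I_n -> 'I_m) (A : 'M[R[i]]_m) :
  mxsub f f A = (coord_embed R f) ^t* *m A *m coord_embed R f.
Proof.
have -> : (coord_embed R f) ^t* = rowsub f 1%:M.
  apply/matrixP => p q; rewrite !mxE eq_sym.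
  by case: eqP => _; rewrite ?rmorph1 ?rmorph0.
rewrite /coord_embed mul_rowsub_mx mul1mx mulmx_colsub mulmx1.
by apply/matrixP => p q; rewrite !mxE.
Qed.

Lemma coord_embedK (R : realType) m n (f : 'I_n -> 'I_m) (x : 'cV[R[i]]_n) :
  injective f -> rowsub f (coord_embed R f *m x) = x.
Proof.
move=> injf; rewrite -mul_rowsub_mx.
suff -> : rowsub f (coord_embed R f) = 1%:M by rewrite mul1mx.
by apply/matrixP => p q; rewrite !mxE (inj_eq injf).
Qed.

Lemma det_mxsub_image (T : comPzRingType) m n (f g : 'I_n -> 'I_m) (A : 'M[T]_m) :
  injective f -> injective g -> f @: 'I_n = g @: 'I_n ->
  \det (mxsub f f A) = \det (mxsub g g A).
Proof.
move=> injf injg eqfg.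
have ex i : exists j, g j == f i.
  have : f i \in g @: 'I_n by rewrite -eqfg imset_f.
  by case/imsetP => j _ ->; exists j.
pose s i := xchoose (ex i).
have gs i : g (s i) = f i by apply/eqP/(xchooseP (ex i)).
have injs : injective s by move=> i j /(congr1 g); rewrite !gs => /injf.
have -> : mxsub f f A = row_perm (perm injs) (col_perm (perm injs) (mxsub g g A)).
  by apply/matrixP => p q; rewrite !mxE !permE !gs.
(* Rows and columns undergo the same permutation, so its sign cancels. *)
rewrite row_permE col_permE !det_mulmx !det_perm odd_permV.
by rewrite mulrCA -signr_addb addbb mulr1.
Qed.

Definition pminor (R : realType) m (A : 'M[R[i]]_m) (J : {set 'I_m}) : R[i] :=
  \det (submatrix A J J).

Lemma image_enum_val (T : finType) (J : {set T}) :
  @enum_val _ (mem J) @: 'I_#|J| = J.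
Proof.
apply/setP => p; apply/imsetP/idP => [[q _ ->]|pJ]; first exact: enum_valP.
by exists (enum_rank_in pJ p); rewrite ?enum_rankK_in.
Qed.

(** The increasing enumeration of J can be replaced by any other one: this frees
    later arguments from the order in which J is listed. *)
Lemma pminorE (R : realType) m n (A : 'M[R[i]]_m) (J : {set 'I_m})
    (f : 'I_n -> 'I_m) :
  injective f -> f @: 'I_n = J -> \det (mxsub f f A) = pminor A J.
Proof.
move=> injf eqJ.
have sJ : n = #|J| by rewrite -eqJ card_imset // card_ord.
subst n; apply: det_mxsub_image => //; first exact: enum_val_inj.
by rewrite image_enum_val.
Qed.

Lemma pminor0 (R : realType) m (A : 'M[R[i]]_m) : pminor A set0 = 1.
Proof.
by rewrite /pminor; move: (submatrix _ _ _); rewrite cards0 => B; rewrite det_mx00.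
Qed.

(** Hence the diagonal of the inverse of A[J] consists of quotients of principal
    minors of A. *)
Lemma cofactor_submatrix (R : realType) m (A : 'M[R[i]]_m) (J : {set 'I_m})
    (l : 'I_#|J|) :
  cofactor (submatrix A J J) l l = pminor A (J :\ enum_val l).
Proof.
rewrite /cofactor -signr_odd addnn odd_double expr0 mul1r.
have -> : row' l (col' l (submatrix A J J)) =
   mxsub (fun i => enum_val (lift l i)) (fun i => enum_val (lift l i)) A.
  by apply/matrixP => p q; rewrite !mxE.
apply: pminorE => [p q /enum_val_inj/lift_inj //|].
apply/setP => p; rewrite in_setD1; apply/imsetP/andP => [[q _ ->]|[pl pJ]].
  by rewrite (inj_eq enum_val_inj) eq_sym neq_lift enum_valP.
set q := enum_rank_in pJ p; have Dp : p = enum_val q by rewrite enum_rankK_in.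
have ql : l != q by apply: contraNneq pl => ->; rewrite Dp.
by case: (unlift_some ql) => r Dr _; exists r; rewrite // Dp Dr.
Qed.

(** * Schur complements extended by zero *)

Lemma mulmx_supported (T : pzRingType) m n p (A : 'M[T]_(m, n)) (X : 'M[T]_(n, p))
    (J : {set 'I_n}) :
  (forall q r, q \notin J -> X q r = 0) ->
  A *m X = subcols A J *m rowsub (@enum_val _ (mem J)) X.
Proof.
move=> X0; apply/matrixP => q r; rewrite !mxE (bigID (mem J)) /=.
rewrite [X in _ + X]big1 ?addr0 => [|s sJ]; last by rewrite X0 ?mulr0.
by rewrite big_enum_val; apply: eq_bigr => s _; rewrite !mxE.
Qed.

Lemma mulmx_col (T : pzRingType) m n p (A : 'M[T]_(m, n)) (X : 'M[T]_(n, p)) j :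
  A *m col j X = col j (A *m X).
Proof.
by apply/matrixP => q r; rewrite !mxE; apply: eq_bigr => s _; rewrite !mxE.
Qed.

(** The Schur complement of A[I], extended by zero to all of [m] x [m] and
    characterised without inverting A[I]: S arises from A by adding to each column
    a combination of the columns indexed by I (Y is the identity off I), and its
    rows indexed by I vanish.  In this form one elimination step is one right
    multiplication of Y. *)
Definition residual (R : realType) m (A : 'M[R[i]]_m) (I : {set 'I_m})
    (S : 'M[R[i]]_m) :=
  exists Y, [/\ S = A *m Y,
    forall p q, p \notin I -> Y p q = (p == q)%:R &
    forall p q, p \in I -> S p q = 0].

Lemma residual0 (R : realType) m (A : 'M[R[i]]_m) : residual A set0 A.
Proof. by exists 1%:M; rewrite mulmx1; split=> // p q; rewrite ?mxE ?inE. Qed.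

(** Since S = A Y vanishes on the rows in I and Y is the identity elsewhere,
    Y^* S = S, so that S = Y^* A Y is congruent to A. *)
Lemma residual_nonneg (R : realType) m (A : 'M[R[i]]_m) I S :
  nonneg_definite A -> residual A I S -> nonneg_definite S.
Proof.
move=> psdA [Y [DS Y1 S0]]; suff -> : S = Y ^t* *m A *m Y by exact: nonneg_congr.
rewrite -mulmxA -DS; apply/matrixP => p q; rewrite !mxE.
have [pI|pI] := boolP (p \in I).
  rewrite S0 // big1 // => r _; rewrite !mxE.
  have [rI|rI] := boolP (r \in I); first by rewrite S0 ?mulr0.
  by rewrite Y1 //; case: eqP pI rI => [-> ->|_ _ _] //; rewrite rmorph0 mul0r.
rewrite (bigD1 p) //= !mxE Y1 // eqxx rmorph1 mul1r big1 ?addr0 // => r /negPf rp.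
rewrite !mxE; have [rI|rI] := boolP (r \in I); first by rewrite S0 ?mulr0.
by rewrite Y1 // rp rmorph0 mul0r.
Qed.

(** With J = j |: I and G = A[J], the part y of column j of Y lying in J satisfies
    G y = S_jj e_j and y_j = 1.  Multiplying by the adjugate of G and reading
    entry j gives det G = S_jj det A[I]. *)
Lemma pminor_setU1 (R : realType) m (A : 'M[R[i]]_m) I S j :
  residual A I S -> j \notin I -> pminor A (j |: I) = pminor A I * S j j.
Proof.
move=> [Y [DS Y1 S0]] jI; set J := j |: I.
have jJ : j \in J by rewrite setU11.
set G := submatrix A J J; pose l := enum_rank_in jJ j.
have Dl : enum_val l = j by rewrite enum_rankK_in.
have Gy : G *m rowsub (@enum_val _ (mem J)) (col j Y) =
          rowsub (@enum_val _ (mem J)) (col j S).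
  have -> : G = rowsub (@enum_val _ (mem J)) (subcols A J).
    by apply/matrixP => p q; rewrite !mxE.
  rewrite mul_rowsub_mx -mulmx_supported => [|p q pJ]; first by rewrite mulmx_col -DS.
  by move: pJ; rewrite mxE !inE negb_or => /andP[/negPf pj pI]; rewrite Y1 ?pj.
move/(congr1 (fun B => (\adj G *m B) l 0)): Gy.
rewrite mulmxA mul_adj_mx mul_scalar_mx !mxE Dl Y1 // eqxx mulr1.
rewrite -[\det G]/(pminor A J) => ->.
rewrite (bigD1 l) //= !mxE Dl cofactor_submatrix Dl setU1K // big1 ?addr0 // => p pl.
rewrite !mxE S0 ?mulr0 //; move: (enum_valP p); rewrite in_setU1 => /orP[/eqP Dp|//].
by move: pl; rewrite -(inj_eq enum_val_inj) Dl Dp eqxx.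
Qed.

(** The elimination S - S e_i e_i^T S / S_ii equals A times
    Y (1 - e_i e_i^T S / S_ii); the second factor modifies only row i of the
    identity, so the shape of Y persists for i |: I. *)
Lemma residual_step (R : realType) m (A : 'M[R[i]]_m) I S i :
  residual A I S -> i \notin I -> S i i != 0 ->
  residual A (i |: I) (\matrix_(p, q) (S p q - S p i * S i q / S i i)).
Proof.
move=> [Y [DS Y1 S0]] iI Sii; exists (Y - (S i i)^-1 *: (col i Y *m row i S)).
have DE (M : 'M_m) p q : (M - (S i i)^-1 *: (col i M *m row i S)) p q =
   M p q - M p i * S i q / S i i.
  by rewrite !mxE big_ord1 !mxE mulrC.
split.
- by apply/matrixP => p q; rewrite mulmxBr -scalemxAr mulmxA mulmx_col -DS DE mxE.
- move=> p q; rewrite in_setU1 negb_or => /andP[/negPf pi pI].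
  by rewrite DE !Y1 // pi !mul0r subr0.
move=> p q; rewrite in_setU1 mxE => /orP[/eqP ->|pI]; last first.
  by rewrite (S0 p q) // (S0 p i) // !mul0r subr0.
by rewrite mulrAC mulfV // mul1r subrr.
Qed.

(** A - S = A (1 - Y) is a combination Z of the columns of A in I, and its rows in
    I are those of A.  This reads A[I] Z = A[I, [m]] and determines Z. *)
Lemma residual_unique (R : realType) m (A : 'M[R[i]]_m) I S :
  A \is hermsymmx -> pminor A I != 0 -> residual A I S ->
  S = A - subcols A I *m invmx (submatrix A I I) *m (subcols A I) ^t*.
Proof.
move=> hA dI [Y [DS Y1 S0]].
pose Z := rowsub (@enum_val _ (mem I)) (1%:M - Y).
have AZ : A - S = subcols A I *m Z.
  rewrite -mulmx_supported => [|p q pI]; last by rewrite !mxE Y1 // subrr.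
  by rewrite mulmxBr mulmx1 -DS.
have GZ : submatrix A I I *m Z = (subcols A I) ^t*.
  have -> : submatrix A I I = rowsub (@enum_val _ (mem I)) (subcols A I).
    by apply/matrixP => p q; rewrite !mxE.
  rewrite mul_rowsub_mx -AZ; apply/matrixP => p q.
  rewrite !mxE S0 ?enum_valP // subr0 -{1}(hermitian_adjoint hA) !mxE //.
rewrite -GZ mulmxA mulmxKV; first by rewrite -AZ opprB addrC subrK.
by rewrite unitmxE unitfE.
Qed.

(** * Entries of nonnegative definite matrices *)

Lemma herm_entry (R : realType) m (S : 'M[R[i]]_m) p q :
  S \is hermsymmx -> S q p = (S p q)^*%R.
Proof. by move=> hS; rewrite -{1}(hermitian_adjoint hS) !mxE. Qed.

Lemma quad_delta (R : realType) m (S : 'M[R[i]]_m) p q (u : R[i]) :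
  let x : 'cV_m := delta_mx p 0 + u *: delta_mx q 0 in
  (x ^t* *m S *m x) 0 0 = S p p + u * S p q + u^*%R * (S q p + u * S q q).
Proof.
move=> x.
have -> : x ^t* = delta_mx 0 p + u^*%R *: delta_mx 0 q.
  by apply/matrixP => a b; rewrite !mxE ord1 eqxx !andbT rmorphD rmorphM !rmorph_nat.
rewrite mulmxDl -scalemxAl -!rowE !mulmxDr -!scalemxAr -!colE !mxE.
by rewrite !mulrDr addrACA -!addrA [u * (_ * _)]mulrCA.
Qed.

Lemma psd_diag_ge0 (R : realType) m (S : 'M[R[i]]_m) p :
  nonneg_definite S -> 0 <= S p p.
Proof.
move=> [hS psdS]; have := psdS (delta_mx p 0 + 0 *: delta_mx p 0).
by rewrite quad_delta rmorph0 !mul0r !addr0.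
Qed.

(** Evaluate the form at e_p + u e_q, where the phase u is chosen so that both
    off-diagonal terms become -|S_pq|: this gives 2 |S_pq| <= S_pp + S_qq.
    It reduces the max-norm of the residual to its diagonal. *)
Lemma psd_entry_le (R : realType) m (S : 'M[R[i]]_m) (c : R[i]) p q :
  nonneg_definite S -> S p p <= c -> S q q <= c -> `|S p q| <= c.
Proof.
move=> psdS pc qc; have c0 := le_trans (psd_diag_ge0 p psdS) pc.
have [->|Spq] := eqVneq (S p q) 0; first by rewrite normr0.
(* u has modulus 1 and u S_pq = - |S_pq|. *)
pose u := - (S p q)^*%R / `|S p q|.
have n0 : `|S p q| != 0 by rewrite normr_eq0.
have uS : u * S p q = - `|S p q|.
  by rewrite /u mulrAC mulNr -normCKC expr2 -mulNr mulfK.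
have uu : u^*%R * u = 1.
  by rewrite -normCKC /u normrM normrN normfV norm_conjC normr_id mulfV // expr1n.
have := (proj2 psdS) (delta_mx p 0 + u *: delta_mx q 0).
rewrite quad_delta (herm_entry p q (proj1 psdS)) mulrDr -rmorphM uS mulrA uu mul1r.
rewrite rmorphN /= conj_Creal ?normr_real // addrA => h.
have h2 : `|S p q| + `|S p q| <= c + c.
  apply: le_trans (lerD pc qc).
  by rewrite -subr_ge0 opprD addrA [_ + S q q - _]addrAC [_ + S q q - _]addrAC.
by move: h2; rewrite -!mulr2n ler_pMn2r.
Qed.

(** * What the greedy algorithm maintains *)

(** The second clause is the trace left by the greedy rule: a remaining diagonal
    entry is at most each of the |I| pivots used so far, and the product of these
    is det A[I].  The last clause, needed when k = 1, keeps a stronger fact about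
    the first pivot: it is the largest diagonal entry of A itself. *)
Definition greedy_inv (R : realType) m (A : 'M[R[i]]_m) (I : {set 'I_m})
    (S : 'M[R[i]]_m) :=
  [/\ residual A I S, forall p, S p p ^+ #|I| <= pminor A I &
      #|I| = 1%N -> forall l, A l l <= pminor A I].

(** All new diagonal entries are at most the pivot S_ii, because elimination
    subtracts |S_pi|^2 / S_ii.  Their power of exponent |I| + 1 is therefore at
    most S_ii^|I| S_ii <= det A[I] S_ii = det A[i |: I]. *)
Lemma greedy_inv_eliminate (R : realType) m (A S : 'M[R[i]]_m) I i :
  nonneg_definite A -> greedy_inv A I S -> i \notin I -> S i i != 0 ->
  (forall j, j \notin I -> S j j <= S i i) ->
  greedy_inv A (i |: I) (\matrix_(p, q) (S p q - S p i * S i q / S i i)).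
Proof.
move=> psdA [resS powS _] iI Sii maxS.
have psdS := residual_nonneg psdA resS.
have S_ge0 p := psd_diag_ge0 p psdS.
have Smax p : S p p <= S i i.
  have [pI|/maxS//] := boolP (p \in I).
  by case: resS => Y [_ _ ->].
set S' := (\matrix_(p, q) _).
have resS' : residual A (i |: I) S' by exact: residual_step.
have S'_le p : S' p p <= S i i.
  rewrite mxE; apply: le_trans (Smax p).
  rewrite gerBl (herm_entry p i (proj1 psdS)).
  by rewrite mulr_ge0 ?invr_ge0 // -normCK exprn_ge0.
rewrite /greedy_inv (pminor_setU1 resS iI) cardsU1 iI add1n; split=> //.
  move=> p; apply: (@le_trans _ _ (S i i ^+ #|I|.+1)).
    rewrite lerXn2r ?nnegrE //.
    exact: psd_diag_ge0 (residual_nonneg psdA resS').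
  by rewrite exprSr ler_wpM2r.
move=> [/cards0_eq I0] l; rewrite I0 pminor0 mul1r.
(* I is empty, hence Y = 1 and the residual is still A. *)
case: resS => Y [DS Y1 _]; suff -> : A = S by exact: Smax.
rewrite DS; suff -> : Y = 1%:M by rewrite mulmx1.
by apply/matrixP => p q; rewrite Y1 ?I0 ?inE // mxE.
Qed.

(** The working matrix of the algorithm agrees with the residual only on K, since
    it leaves the other entries stale.  A vanishing pivot would make the minor of
    i |: I vanish, so the degenerate exit never occurs. *)
Lemma greedy_loop_inv (R : realType) m (A : 'M[R[i]]_m) k B I K t Iout tout :
  nonneg_definite A -> (forall J, pminor A J != 0) ->
  greedy_loop k B I K t Iout tout ->
  K = ~: I ->
  (exists S, greedy_inv A I S /\ forall p q, p \in K -> q \in K -> B p q = S p q) ->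
  #|Iout| = k /\ exists S, greedy_inv A Iout S.
Proof.
move=> psdA pm0; elim=> {B I K t Iout tout}.
- move=> B I K t i [iK _] Bii DK [S [[resS _ _] BS]].
  have iI : i \notin I by rewrite DK inE in iK.
  by have := pm0 (i |: I); rewrite (pminor_setU1 resS iI) -BS // Bii mulr0 eqxx.
- move=> B I K t i [iK maxB] Bii sk DK [S [invS BS]]; split=> //.
  have iI : i \notin I by rewrite DK inE in iK.
  exists (\matrix_(p, q) (S p q - S p i * S i q / S i i)).
  apply: greedy_inv_eliminate => //.
    by rewrite -BS //; apply/eqP.
  by move=> j jI; have jK : j \in K; [rewrite DK inE | rewrite -!BS ?maxB].
move=> B I K t i Iout tout [iK maxB] Bii sk _ IH DK [S [invS BS]].
have iI : i \notin I by rewrite DK inE in iK.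
apply: IH.
  by rewrite DK; apply/setP => p; rewrite !inE negb_or.
exists (\matrix_(p, q) (S p q - S p i * S i q / S i i)); split.
  apply: greedy_inv_eliminate => //; first by rewrite -BS //; apply/eqP.
  by move=> j jI; have jK : j \in K; [rewrite DK inE | rewrite -!BS ?maxB].
move=> p q pK' qK'; rewrite !mxE pK' qK' /=.
by move: pK' qK'; rewrite !in_setD1 => /andP[_ pK] /andP[_ qK]; rewrite !BS.
Qed.

Lemma greedy_returns_inv (R : realType) m (A : 'M[R[i]]_m) k I t :
  nonneg_definite A -> (forall J, pminor A J != 0) ->
  greedy_returns A k I t -> #|I| = k /\ exists S, greedy_inv A I S.
Proof.
move=> psdA pm0 /(greedy_loop_inv psdA pm0); apply; first by rewrite setC0.
exists A; split=> //; split; first exact: residual0.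
  by move=> p; rewrite cards0 pminor0 expr0.
by rewrite cards0.
Qed.

(** * Lower bounds for singular values *)

(** More than k entries are at least theta, whereas the k entries preceding
    position k are the only ones that can exceed the entry at that position. *)
Lemma nth_sort_ge (R : realType) (s : seq R) (theta : R) k :
  (k < count (fun x : R => (theta <= x)%R) s)%N ->
  theta <= nth 0 (sort (fun x y : R => y <= x) s) k.
Proof.
set r := (fun x y : R => y <= x); set s' := sort r s.
have -> : count (fun x : R => (theta <= x)%R) s =
          count (fun x : R => (theta <= x)%R) s'.
  suff /seq.permP -> : perm_eq s s' by [].
  by rewrite perm_sym perm_sort.
have ss' : sorted r s' by apply: sort_sorted => x y; rewrite /r le_total.
apply: contraLR; rewrite -ltNge -leqNgt => lt_k.
rewrite -[s'](cat_take_drop k) count_cat.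
have /eqP-> : count (fun x : R => (theta <= x)%R) (drop k s') == 0%N.
  rewrite -leqn0 leqNgt -has_count; apply/(has_nthP 0) => -[ i ].
  rewrite size_drop nth_drop => lt_i; apply/negP; rewrite -ltNge.
  apply: le_lt_trans lt_k.
  have sz : (k + i < size s')%N by rewrite -ltn_subRL.
  apply: (sorted_leq_nth _ _ 0 ss') => //; rewrite ?inE ?leq_addr //.
  - by move=> y x' z; rewrite /r => yx zy; exact: le_trans zy yx.
  - by move=> y; rewrite /r.
  exact: leq_ltn_trans (leq_addr _ _) sz.
rewrite addn0 (leq_trans (count_size _ _)) // size_take.
by case: ltnP.
Qed.

Lemma exists_kernel_vector (F : fieldType) p q (Q : 'M[F]_(q, p)) : (q < p)%N ->
  exists2 x : 'cV_p, x != 0 & Q *m x = 0.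
Proof.
move=> qp; have : kermx Q^T != 0.
  rewrite kermx_eq0 /row_free neq_ltn (leq_ltn_trans _ qp) //; exact: rank_leq_col.
case/rowV0Pn => v /sub_kermxP vQ v0; exists v^T.
  by apply: contraNneq v0 => v0; rewrite -[v]trmxK v0 trmx0.
by rewrite -[Q]trmxK -trmx_mul vQ trmx0.
Qed.

Lemma gram_nonneg (R : realType) m n (N : 'M[R[i]]_(m, n)) :
  nonneg_definite (N ^t* *m N).
Proof.
split; first by apply: adjoint_hermitian; rewrite adjointM trmxCK.
move=> x; rewrite mulmxA -adjointM -mulmxA sqnormE.
by apply: sumr_ge0 => j _; rewrite exprn_ge0.
Qed.

(** The min-max principle, in one direction.  If at most k eigenvalues of N^* N
    reached theta, the range of F, of dimension p > k, would contain a nonzero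
    vector with no component along their eigenvectors, and there |N z|^2 would be
    strictly less than theta |z|^2. *)
Lemma gram_eigenvalue_ge (R : realType) m n p k (N : 'M[R[i]]_(m, n))
    (F : 'M[R[i]]_(n, p)) (theta : R) :
  (k < p)%N -> (forall x : 'cV_p, F *m x = 0 -> x = 0) ->
  (forall y : 'cV_p, theta%:C * ((F *m y) ^t* *m (F *m y)) 0 0 <=
     ((N *m (F *m y)) ^t* *m (N *m (F *m y))) 0 0) ->
  theta <= nth 0 (gram_eigenvalues N) k.
Proof.
move=> kp injF geN; apply: nth_sort_ge; rewrite count_map.
set M := N ^t* *m N; pose d j := complex.Re (spectral_diag M 0 j).
have psdM : nonneg_definite M := gram_nonneg N.
have dE j : spectral_diag M 0 j = (d j)%:C.
  by rewrite RRe_real // ger0_real // spectral_diag_ge0.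
(* T indexes the eigenvalues that reach theta; the goal is k < |T|. *)
pose T := [set j | theta <= d j].
have -> : count (preim d (fun x : R => (theta <= x)%R)) (enum 'I_n) = #|T|.
  by rewrite cardsE cardE -size_filter /enum_mem -enumT filter_predT.
rewrite ltnNge; apply/negP => Tk.
pose P := spectralmx M.
have [x x0 Qx] :=
  exists_kernel_vector (rowsub (@enum_val _ (mem T)) (P *m F)) (leq_ltn_trans Tk kp).
pose y := P *m (F *m x).
have yT j : j \in T -> y j 0 = 0.
  move=> jT; move/matrixP/(_ (enum_rank_in jT j) 0): Qx.
  by rewrite mul_rowsub_mx -mulmxA -/y [LHS]mxE [RHS]mxE enum_rankK_in.
have := geN x.
rewrite [X in _ <= X -> _](_ : _ = ((F *m x) ^t* *m M *m (F *m x)) 0 0); last first.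
  by rewrite adjointM !mulmxA.
rewrite quad_spectral ?(proj1 psdM) // -(sqnorm_spectralmx M) -/P -/y mulr_sumr.
rewrite -subr_le0 -sumrB => le0.
(* The sum of (theta - lambda_j) |y_j|^2 is at most 0 while all its terms are
   nonnegative, so every term vanishes. *)
have ge0 j : 0 <= theta%:C * `|y j 0| ^+ 2 - spectral_diag M 0 j * `|y j 0| ^+ 2.
  rewrite -mulrBl; have [jT|] := boolP (j \in T).
    by rewrite yT // normr0 expr0n mulr0.
  rewrite inE -ltNge => /ltW dj.
  by rewrite mulr_ge0 ?exprn_ge0 // subr_ge0 dE lecR.
have /allP z0 : all (fun j => true ==> (theta%:C * `|y j 0| ^+ 2 -
    spectral_diag M 0 j * `|y j 0| ^+ 2 == 0)) (index_enum 'I_n).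
  by rewrite -psumr_eq0 // eq_le le0 sumr_ge0.
move/eqP: x0; apply; apply: injF.
suff : y = 0.
  by move/(congr1 (mulmx (invmx P))); rewrite mulKmx ?spectral_unit // mulmx0.
apply/matrixP => j l; rewrite ord1 [RHS]mxE.
have [jT|jT] := boolP (j \in T); first by rewrite yT.
have := z0 j (mem_index_enum _); rewrite /= -mulrBl mulf_eq0 sqrf_eq0 normr_eq0.
case/orP => [|/eqP//]; rewrite dE subr_eq0 => /eqP/complexI tE.
by move: jT; rewrite inE tE lexx.
Qed.

(** The inverse of an eigenvalue is an eigenvalue of the inverse, and is thus at
    most the sum of all eigenvalues of the inverse. *)
Lemma spectral_diag_trace_inv (R : realType) m (G : 'M[R[i]]_m) j :
  nonneg_definite G -> 0 < \det G -> 1 <= spectral_diag G 0 j * \tr (invmx G).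
Proof.
move=> psdG detG; have hG := proj1 psdG.
have Gu : G \in unitmx by rewrite unitmxE unitfE gt_eqF.
pose P := spectralmx G.
have Pu : P *m P ^t* = 1%:M := unitarymxP (spectral_unitarymx G).
pose K := P *m invmx G *m P ^t*.
(* In the eigenbasis of G the inverse is K, so K inverts a diagonal matrix. *)
have DK : diag_mx (spectral_diag G) *m K = 1%:M.
  have -> : diag_mx (spectral_diag G) = P *m G *m P ^t*.
    by rewrite {2}(spectral_decomp hG) -/P !mulmxA Pu mul1mx -mulmxA Pu mulmx1.
  rewrite /K !mulmxA -[_ *m P ^t* *m P]mulmxA.
  have -> : P ^t* *m P = 1%:M by apply: mulmx1C.
  by rewrite mulmx1 mulmxK.
have Kjj l : spectral_diag G 0 l * K l l = 1.
  by move/matrixP/(_ l l): DK; rewrite mul_diag_mx !mxE eqxx.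
have K_ge0 l : 0 <= K l l.
  by rewrite -(pmulr_rge0 _ (spectral_diag_gt0 l psdG detG)) Kjj.
have -> : \tr (invmx G) = \tr K.
  by rewrite /K mxtrace_mulC mulmxA (mulmx1C Pu) mul1mx.
rewrite -(Kjj j) ler_wpM2l ?spectral_diag_ge0 // /mxtrace (bigD1 j) //= lerDl.
by apply: sumr_ge0.
Qed.

(** In eigencoordinates G multiplies each component by an eigenvalue >= a. *)
Lemma sqnorm_mulmx_ge (R : realType) m (G : 'M[R[i]]_m) (a : R[i]) (x : 'cV_m) :
  G \is hermsymmx -> 0 <= a -> (forall j, a <= spectral_diag G 0 j) ->
  a ^+ 2 * (x ^t* *m x) 0 0 <= ((G *m x) ^t* *m (G *m x)) 0 0.
Proof.
move=> hG a0 aG; rewrite -!(sqnorm_spectralmx G) mulr_sumr.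
have -> : spectralmx G *m (G *m x) = diag_mx (spectral_diag G) *m (spectralmx G *m x).
  rewrite {2}(spectral_decomp hG) !mulmxA (unitarymxP (spectral_unitarymx G)).
  by rewrite mul1mx.
move: (spectralmx G *m x) => y.
apply: ler_sum => j _; rewrite mul_diag_mx mxE normrM exprMn ler_wpM2r ?exprn_ge0 //.
by rewrite lerXn2r ?nnegrE // ger0_norm // (le_trans a0).
Qed.

(** * The residual against the next singular value *)

Lemma sqnorm_rowsub_le (R : realType) m (J : {set 'I_m}) (z : 'cV[R[i]]_m) :
  ((rowsub (@enum_val _ (mem J)) z) ^t* *m rowsub (@enum_val _ (mem J)) z) 0 0 <=
  (z ^t* *m z) 0 0.
Proof.
rewrite !sqnormE; under eq_bigr do rewrite mxE.
rewrite -(big_enum_val (fun p => `|z p 0| ^+ 2)) [leRHS](bigID (mem J)) /= lerDl.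
by apply: sumr_ge0 => p _; rewrite exprn_ge0.
Qed.

Lemma pminor_gt0 (R : realType) m (A : 'M[R[i]]_m) J :
  nonneg_definite A -> 0 < \det A -> 0 < pminor A J.
Proof.
move=> psdA detA; rewrite /pminor /submatrix mxsub_congr.
apply: det_congr_gt0 => // x Ex.
rewrite -(coord_embedK x (@enum_val_inj _ (mem J))) Ex.
by apply/matrixP => p q; rewrite !mxE.
Qed.

Lemma trace_inv_submatrix (R : realType) m (A : 'M[R[i]]_m) (J : {set 'I_m}) :
  pminor A J != 0 ->
  \tr (invmx (submatrix A J J)) = \sum_(l in J) pminor A (J :\ l) / pminor A J.
Proof.
move=> pJ; rewrite big_enum_val; apply: eq_bigr => l _.
by rewrite /invmx unitmxE unitfE pJ !mxE cofactor_submatrix mulrC.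
Qed.

(** Put J = j |: I and G = A[J].  The diagonal entries of the inverse of G are the
    quotients of det A[J \ l] by det A[J] = det A[I] S_jj, hence at most rho / S_jj,
    and the trace of the inverse is at most (|I| + 1) rho / S_jj.  So all
    eigenvalues of G are at least S_jj / ((|I| + 1) rho).  Vectors supported in J
    are then stretched by A at least by this factor, and they form a space of
    dimension |I| + 1, which bounds the singular value of that index from below. *)
Lemma residual_le_singular (R : realType) m (A S : 'M[R[i]]_m) I j (rho : R) :
  nonneg_definite A -> 0 < \det A -> residual A I S -> j \notin I -> 0 < rho ->
  (forall l, l \in j |: I -> pminor A ((j |: I) :\ l) <= rho%:C * pminor A I) ->
  S j j <= (#|I|.+1%:R * rho * singular_value A #|I|.+1)%:C.
Proof.
move=> psdA detA resS jI rho0; set J := j |: I => minor_le.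
have pm_gt0 T := pminor_gt0 T psdA detA.
have SJ : pminor A J = pminor A I * S j j by exact: pminor_setU1.
have Sjj_gt0 : 0 < S j j by rewrite -(pmulr_rgt0 _ (pm_gt0 I)) -SJ.
set G := submatrix A J J; pose E := coord_embed R (@enum_val _ (mem J)).
have GE : G = E ^t* *m A *m E by exact: mxsub_congr.
have psdG : nonneg_definite G by rewrite GE; apply: nonneg_congr.
pose c : R := #|I|.+1%:R * rho.
have c_gt0 : 0 < c by rewrite mulr_gt0.
have tr_le : \tr (invmx G) <= c%:C / S j j.
  rewrite trace_inv_submatrix ?gt_eqF //.
  have -> : c%:C / S j j = \sum_(l in J) rho%:C / S j j.
    by rewrite sumr_const cardsU1 jI add1n -mulrnAl /c mulr_natl rmorphMn.
  apply: ler_sum => l lJ; rewrite SJ ler_pdivrMr ?mulr_gt0 //.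
  by rewrite [_ * S j j]mulrC mulrA mulfVK ?gt_eqF // minor_le.
pose a := S j j / c%:C.
have cC_gt0 : 0 < c%:C by rewrite ltcR.
have a_ge0 : 0 <= a by rewrite divr_ge0 ?ltW.
have aE : a = (complex.Re a)%:C by rewrite RRe_real // ger0_real.
have a_le l : a <= spectral_diag G 0 l.
  rewrite /a ler_pdivrMr // -[S j j]mul1r -ler_pdivlMr // -mulrA.
  apply: le_trans (spectral_diag_trace_inv l psdG (pm_gt0 J)) _.
  by rewrite ler_wpM2l // spectral_diag_ge0.
have EE : E ^t* *m E = 1%:M.
  rewrite -[E ^t*]mulmx1 -mxsub_congr; apply/matrixP => p q.
  by rewrite !mxE (inj_eq enum_val_inj).
have : complex.Re a ^+ 2 <= nth 0 (gram_eigenvalues A) #|I|.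
  apply: (@gram_eigenvalue_ge _ _ _ #|J| _ _ E).
  - by rewrite cardsU1 jI.
  - by move=> x Ex; rewrite -[x]mul1mx -EE -mulmxA Ex mulmx0.
  move=> y; rewrite rmorphXn /= -aE [in leLHS]adjointM -mulmxA.
  rewrite [E ^t* *m _]mulmxA EE mul1mx.
  apply: le_trans (sqnorm_mulmx_ge y (proj1 psdG) a_ge0 a_le) _.
  have -> : G *m y = rowsub (@enum_val _ (mem J)) (A *m (E *m y)).
    rewrite mulmxA -mul_rowsub_mx /E /coord_embed mulmx_colsub mulmx1.
    by congr (_ *m _); apply/matrixP => p q; rewrite !mxE.
  exact: sqnorm_rowsub_le.
move/ler_wsqrtr; rewrite sqrtr_sqr ger0_norm; last by rewrite -lecR -aE.
by rewrite -lecR -aE /a ler_pdivrMr // mulrC -rmorphM.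
Qed.

(** * Comparing minors *)

Lemma pminor_le_max_minor (R : realType) m (A : 'M[R[i]]_m) J :
  0 <= pminor A J -> pminor A J <= (max_minor A #|J|)%:C.
Proof.
move=> pJ; rewrite -[leLHS]ger0_norm // lecR.
rewrite (_ : ComplexField.Normc.normc _ = ComplexField.Normc.normc
  (\det (conform_mx (0 : 'M_#|J|) (submatrix A J J)))); last by rewrite conform_mx_id.
apply: le_trans (le_bigmax_cond _ _ (eqxx #|J|)).
exact: (le_bigmax_cond _ _ (eqxx #|J|)).
Qed.

Lemma pminor_mono (R : realType) m (A : 'M[R[i]]_m) (I J : {set 'I_m}) :
  nonneg_definite A -> 0 < \det A -> nondecreasing_setfun (trlog A) ->
  I \subset J -> pminor A I <= pminor A J.
Proof.
move=> psdA detA mono IJ; have := mono _ _ IJ; rewrite /trlog.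
have pE T : pminor A T = (complex.Re (pminor A T))%:C.
  by rewrite RRe_real // gtr0_real // pminor_gt0.
have psdT T : nonneg_definite (submatrix A T T).
  by rewrite /submatrix mxsub_congr; exact: nonneg_congr.
rewrite !trace_mxlog ?pminor_gt0 // -/(pminor A I) -/(pminor A J).
by rewrite ler_ln ?posrE -?ltcR -?pE ?pminor_gt0 // => ?; rewrite pE [leRHS]pE lecR.
Qed.

(** From exp (-1/6) >= 5/6 one gets e <= (6/5)^6 < 3. *)
Lemma expR1_le3 (R : realType) : expR 1 <= 3 :> R.
Proof.
have h : 5 / 6 <= expR (- (1 / 6)) :> R.
  by apply: le_trans (expR_ge1Dx _); lra.
have -> : expR 1 = expR (6%:R * (1 / 6)) :> R by congr expR; lra.
rewrite expRM_natl -[expR _]invrK -expRN exprVn.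
rewrite -[leRHS]invrK lef_pV2 ?posrE ?exprn_gt0 ?expR_gt0 ?invr_gt0 //.
apply: (@le_trans _ _ ((5 / 6) ^+ 6)); first by lra.
by rewrite lerXn2r ?nnegrE ?expR_ge0 //; lra.
Qed.

(** Here dI and dJ stand for the minors of the greedy set I and of another k-subset
    J of j |: I, and s for S_jj.  The ratio r = dJ / dI is at most s, so
    r^(k+1) <= r dI = dJ <= mu.  For k >= 2 the exponent 1/(k+1) is at most 1/3 and
    hence at most 1/e.  For k = 1 it is too large, and the choice of the first
    pivot gives r <= 1 instead. *)
Lemma minor_ratio_le (R : realType) k (dI dJ s mu : R) :
  (1 <= k)%N -> 1 <= dI -> 0 <= dJ -> dJ <= dI * s -> s ^+ k <= dI ->
  dJ <= mu -> 1 <= mu -> (k = 1%N -> dJ <= dI) ->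
  dJ <= mu `^ (expR 1)^-1 * dI.
Proof.
move=> k0 dI1 dJ0 dJs sk dJmu mu1 k1.
have dI0 : 0 < dI := lt_le_trans ltr01 dI1.
have e0 : 0 < (expR 1)^-1 :> R by rewrite invr_gt0 expR_gt0.
have [k_eq1|k_neq1] := eqVneq k 1%N.
  apply: le_trans (k1 k_eq1) _; rewrite ler_peMl ?(ltW dI0) //.
  by rewrite -[leLHS](powRr0 mu) ler_powR // ltW.
rewrite -ler_pdivrMr //; set r := dJ / dI.
have r0 : 0 <= r by rewrite divr_ge0 // ltW.
have rs : r <= s by rewrite ler_pdivrMr // mulrC.
have rk : r ^+ k.+1 <= mu.
  apply: le_trans dJmu; rewrite exprS -[leRHS](@divfK _ dI) ?gt_eqF //.
  by rewrite ler_wpM2l // (le_trans _ sk) // lerXn2r ?nnegrE // (le_trans r0).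
have -> : r = (r ^+ k.+1) `^ k.+1%:R^-1.
  by rewrite -powR_mulrn // -powRrM mulfV ?powRr1 // pnatr_eq0.
apply: (@le_trans _ _ (mu `^ k.+1%:R^-1)).
  by rewrite ge0_ler_powR ?nnegrE ?invr_ge0 ?exprn_ge0 // (le_trans ler01).
rewrite ler_powR // lef_pV2 ?posrE ?expR_gt0 // (le_trans (expR1_le3 R)) // ler_nat.
by case: k k0 k_neq1 {sk k1 rk} => [|[|k]].
Qed.

Theorem proposition12 (R : realType) (m k : nat) (A : 'M[R[i]]_m)
    (hm : (2 <= m)%N) (hk : (1 <= k <= m)%N)
    (hA : nonneg_definite A) (hdet : 0 < \det A)
    (hw : nondecreasing_setfun (trlog A))
    (I : {set 'I_m}) (t : R[i]) (hI : greedy_returns A k I t) :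
  maxnorm (A - subcols A I *m invmx (submatrix A I I) *m (subcols A I) ^t*)
  <= k.+1%:R * (max_minor A k `^ (expR 1)^-1) * singular_value A k.+1.
Proof.
have pm_gt0 J := pminor_gt0 J hA hdet.
have pm_neq0 J : pminor A J != 0 by rewrite gt_eqF.
have [cardI [S [resS powS pivot1]]] := greedy_returns_inv hA pm_neq0 hI.
rewrite -(residual_unique (proj1 hA) (pm_neq0 I) resS).
have psdS := residual_nonneg hA resS.
have pm_ge1 J : 1 <= pminor A J.
  by rewrite -(pminor0 A); apply: pminor_mono; rewrite ?sub0set.
set rho := max_minor A k `^ (expR 1)^-1; set C := _ * _ * _.
have pE J : pminor A J = (complex.Re (pminor A J))%:C.
  by rewrite RRe_real // gtr0_real.
have SE p : S p p = (complex.Re (S p p))%:C.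
  by rewrite RRe_real // ger0_real // psd_diag_ge0.
have mu_ge (J : {set 'I_m}) : #|J| = k -> complex.Re (pminor A J) <= max_minor A k.
  by move=> <-; rewrite -lecR -pE; apply: pminor_le_max_minor; apply: ltW.
have mu1 : 1 <= max_minor A k.
  by apply: le_trans (mu_ge I cardI); rewrite -lecR -pE.
have rho_gt0 : 0 < rho by rewrite powR_gt0 // (lt_le_trans ltr01).
have C_ge0 : 0 <= C by rewrite !mulr_ge0 ?sqrtr_ge0 // ltW.
have diag_le p : S p p <= C%:C.
  have [pI|pI] := boolP (p \in I).
    by case: resS => Y [_ _ ->] //; rewrite lecR.
  rewrite /C -cardI; apply: (residual_le_singular hA hdet resS pI rho_gt0) => l lJ.
  set J := _ :\ l; have cardJ : #|J| = k.
    by have := cardsD1 l (p |: I); rewrite cardsU1 pI lJ cardI => -[].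
  rewrite pE [pminor A I]pE -rmorphM lecR.
  apply: (@minor_ratio_le _ k _ _ (complex.Re (S p p))).
  - by case/andP: hk.
  - by rewrite -lecR -pE.
  - by rewrite -lecR -pE ltW.
  (* J is a subset of p |: I, so the monotonicity of w applies. *)
  - rewrite -lecR rmorphM /= -!pE -SE -(pminor_setU1 resS pI).
    by apply: pminor_mono; rewrite ?subD1set.
  - by rewrite -lecR rmorphXn /= -SE -pE -cardI.
  - exact: mu_ge.
  - exact: mu1.
  move=> k1; rewrite -lecR -!pE.
  have /eqP/cards1P[q ->] := etrans cardJ k1.
  have -> : pminor A [set q] = A q q.
    have := pminor_setU1 (residual0 A) (_ : q \notin set0).
    by rewrite setU0 pminor0 mul1r => ->; rewrite ?inE.
  by apply: pivot1; rewrite cardI.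
rewrite /maxnorm; do 2![apply: bigmax_le => // ? _].
by rewrite -lecR; apply: psd_entry_le.
Qed.
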